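(* Suppose that $b$ satisfies assumptions (B1)–(B4) of the context. Then the equation $$Y_t=Y_0+\int_0^t b(s,Y_s)\,ds+Z_t,\qquad t\in[0,T],$$ has a unique solution $Y=\{Y_t,\ t\in[0,T]\}$ such that $$\varphi(t)<Y_t<\psi(t),\qquad t\in[0,T].$$
   Context: Fix $T\in(0,\infty)$ and $\lambda\in(0,1)$. Let $\varphi,\psi:[0,T]\to\mathbb R$ be $\lambda$-Hölder continuous functions with $\varphi(t)<\psi(t)$ for all $t\in[0,T]$. For $a_1,a_2\ge 0$ let $\mathcal D_{a_1,a_2}:=\{(t,y) : t\in[0,T],\ y\in(\varphi(t)+a_1,\psi(t)-a_2)\}$. $\|\cdot\|_\infty$ is the sup norm on $[0,T]$. The initial value $Y_0$ is a deterministic constant with $\varphi(0)<Y_0<\psi(0)$. The noise $Z=\{Z_t,\ t\in[0,T]\}$ is a stochastic process such that $Z_0=0$ a.s. and there is a random variable $\Lambda=\Lambda(\omega)\in(0,\infty)$ with $|Z_t-Z_s|\le\Lambda|t-s|^\lambda$ for all $t,s\in[0,T]$. All equations are understood pathwise. Assumptions on the drift $b$: (B1) $b:\mathcal D_{0,0}\to\mathbb R$ is continuous. (B2) For any $\varepsilon_1,\varepsilon_2>0$ with $\varepsilon_1+\varepsilon_2<\|\varphi-\psi\|_\infty$ there is a constant $c_{\varepsilon_1,\varepsilon_2}>0$ such that $|b(t,y_1)-b(t,y_2)|\le c_{\varepsilon_1,\varepsilon_2}|y_1-y_2|$ for all $(t,y_1),(t,y_2)\in\mathcal D_{\varepsilon_1,\varepsilon_2}$.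 (B3) There are constants $\gamma>0$, $y_*>0$ with $y_*<\frac12\|\varphi-\psi\|_\infty$, and $c>0$ such that $b(t,y)\ge\frac{c}{(y-\varphi(t))^\gamma}$ for all $(t,y)\in\mathcal D_{0,0}\setminus\mathcal D_{y_*,0}$, and $b(t,y)\le-\frac{c}{(\psi(t)-y)^\gamma}$ for all $(t,y)\in\mathcal D_{0,0}\setminus\mathcal D_{0,y_*}$. (B4) The constant $\gamma$ from (B3) satisfies $\gamma>\frac{1-\lambda}{\lambda}$. *)

(* Defs.v *)
From HB Require Import structures.
From mathcomp Require Import all_boot all_order all_algebra.
From mathcomp Require Import all_classical all_reals all_analysis.

Set Implicit Arguments.
Unset Strict Implicit.
Unset Printing Implicit Defensive.

Import Order.TTheory GRing.Theory Num.Theory.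
Import numFieldNormedType.Exports.

Local Open Scope classical_set_scope.
Local Open Scope ring_scope.

(* Functions of time are total functions on R of which only the values on
   [0, T] matter; likewise the drift [b] is a total function of which only the
   values on [domain T phi psi 0 0] matter. *)

Definition holder_bound (R : realType) (T lambda K : R) (f : R -> R) : Prop :=
  forall t s : R, t \in `[0, T] -> s \in `[0, T] ->
    `|f t - f s| <= K * `|t - s| `^ lambda.

Definition holder_on (R : realType) (T lambda : R) (f : R -> R) : Prop :=
  exists K : R, holder_bound T lambda K f.

Definition sup_norm (R : realType) (T : R) (f : R -> R) : R :=
  sup [set `|f t| | t in `[0, T]].

Definition domain (R : realType) (T : R) (phi psi : R -> R) (a1 a2 : R) :
    set (R * R) :=
  [set p | 0 <= p.1 <= T /\ phi p.1 + a1 < p.2 < psi p.1 - a2].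

Definition drift_continuous (R : realType) (T : R) (phi psi : R -> R)
    (b : R -> R -> R) : Prop :=
  {within domain T phi psi 0 0, continuous (fun p : R * R => b p.1 p.2)}.

Definition drift_locally_lipschitz (R : realType) (T : R) (phi psi : R -> R)
    (b : R -> R -> R) : Prop :=
  forall eps1 eps2 : R, 0 < eps1 -> 0 < eps2 ->
    eps1 + eps2 < sup_norm T (phi \- psi) ->
    exists2 c : R, 0 < c &
      forall t y1 y2 : R,
        domain T phi psi eps1 eps2 (t, y1) ->
        domain T phi psi eps1 eps2 (t, y2) ->
        `|b t y1 - b t y2| <= c * `|y1 - y2|.

Definition drift_explosive (R : realType) (T : R) (phi psi : R -> R)
    (gamma : R) (b : R -> R -> R) : Prop :=
  0 < gamma /\
  exists ystar c : R,
    [/\ 0 < ystar, ystar < 2^-1 * sup_norm T (phi \- psi), 0 < c,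
        (forall t y : R,
          (domain T phi psi 0 0 `\` domain T phi psi ystar 0) (t, y) ->
          c / (y - phi t) `^ gamma <= b t y) &
        (forall t y : R,
          (domain T phi psi 0 0 `\` domain T phi psi 0 ystar) (t, y) ->
          b t y <= - (c / (psi t - y) `^ gamma))].

Definition holder_noise (R : realType) (d : measure_display)
    (Omega : measurableType d) (P : probability Omega R) (T lambda : R)
    (Z : R -> {RV P >-> R}) : Prop :=
  {ae P, forall omega, Z 0 omega = 0} /\
  exists Lambda : {RV P >-> R}, forall omega,
    0 < Lambda omega /\
    holder_bound T lambda (Lambda omega) (fun t => Z t omega).

(* The integrability clause makes the integral in the equation meaningful:
   [Rintegral] takes a default value on non-integrable functions. *)
Definition sandwiched_solution (R : realType) (T : R) (phi psi : R -> R)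
    (b : R -> R -> R) (Y0 : R) (z y : R -> R) : Prop :=
  (@lebesgue_measure R).-integrable `[0, T] (EFin \o (fun s => b s (y s))) /\
  forall t : R, t \in `[0, T] ->
    y t = Y0 + \int[@lebesgue_measure R]_(s in `[0, t]) b s (y s) + z t /\
    phi t < y t < psi t.

(* Main.v *)
Require Import Defs.
From HB Require Import structures.
From mathcomp Require Import all_boot all_order all_algebra.
From mathcomp Require Import all_classical all_reals all_analysis.
From mathcomp Require Import measurable_realfun ring lra.

(** Push the drift away from its two singularities: evaluate [b] at the
    projection of [y] on [phi + e, psi - e]. As [b] is Lipschitz away from the
    boundaries, the resulting drift is globally Lipschitz in [y], so the
    equation driven by it has a solution on [0, T] for every path of the noise
    ([picard_existence]).

    What makes the theorem true is that, on each path, this solution stays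
    inside the strip where the truncation is invisible as soon as [e] is small
    ([truncated_solution_confined]). Follow [u = y - phi] since the last time it
    was at least [2 * e]. From then on the drift is at least [c / (2 * e)^gamma],
    whereas the noise and [phi] can pull [u] down by at most [K * x^lambda] in
    time [x]. To fall further to the level [e] one would need
    [c / (2 * e)^gamma * x + e <= K * x^lambda] for some [x]. The second term on
    the left forces [x >= (e / K)^(1 / lambda)], the first one forces
    [x^(1 - lambda) <= (K / c) * (2 * e)^gamma], and the two are incompatible
    for small [e] because [gamma > (1 - lambda) / lambda]
    ([holder_loses_to_singular_drift], [barrier_not_crossed]). The same argument
    works for [psi - y].

    Uniqueness in the strip ([sandwiched_solution_unique]) holds because a
    solution is continuous, hence keeps a positive distance from both
    boundaries on the compact interval [0, T], and [b] is Lipschitz there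
    ([gronwall_uniqueness]).

    The threshold for [e] depends on the path, so measurability in [omega] is
    obtained by limits: [Y t] is the pointwise limit, over truncation levels
    tending to [0], of the truncated solutions, each of which is the limit of
    explicit Euler schemes ([euler_cvg]), whose values are measurable because
    they are built from finitely many values of the noise. *)

Set Implicit Arguments.
Unset Strict Implicit.
Unset Printing Implicit Defensive.

Import Order.TTheory GRing.Theory Num.Theory.
Import numFieldNormedType.Exports.

Local Open Scope classical_set_scope.
Local Open Scope ring_scope.

(** * Exponentially weighted contraction and Gronwall uniqueness *)

Lemma continuous_integrable_segment (R : realType) (g : R -> R) (a b : R) :
  continuous g ->
  (@lebesgue_measure R).-integrable `[a, b] (EFin \o g).
Proof.
move=> cg; apply: continuous_compact_integrable; first exact: segment_compact.
exact: continuous_subspaceT.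
Qed.

Lemma integrable_prefix (R : realType) (g : R -> R) (T t : R) :
  t <= T -> (@lebesgue_measure R).-integrable `[0, T] (EFin \o g) ->
  (@lebesgue_measure R).-integrable `[0, t] (EFin \o g).
Proof.
move=> tT; apply: integrableS => //.
by apply: subset_itvl; rewrite bnd_simp.
Qed.

Lemma continuous_exp_weight (R : realType) (L B : R) :
  continuous (fun s => L * (B * expR (2 * L * s))).
Proof.
move=> s; apply: cvgMl_tmp; apply: cvgMl_tmp.
apply: continuous_comp; last exact: continuous_expR.
by apply: cvgMl_tmp; exact: cvg_id.
Qed.

Lemma integral_exp_weight (R : realType) (L B t : R) : 0 < L -> 0 <= t ->
  \int[@lebesgue_measure R]_(s in `[0, t]) (L * (B * expR (2 * L * s))) =
  B / 2 * (expR (2 * L * t) - 1).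
Proof.
move=> L0; rewrite le_eqVlt => /predU1P[<-|t0].
  by rewrite set_itv1 Rintegral_set1 mulr0 expR0 subrr mulr0.
pose F (s : R) := B / 2 * expR (2 * L * s).
have dF (s : R) : is_derive s 1 F (L * (B * expR (2 * L * s))).
  apply: is_derive_eq.
  rewrite /GRing.scale/=; lra.
have cF : continuous F.
  by move=> s; apply: differentiable_continuous; apply/derivable1_diffP;
    case: (dF s).
have cE := @continuous_exp_weight R L B.
rewrite /Rintegral (@continuous_FTC2 _ _ F) //.
- by rewrite -EFinB /= /F mulr0 expR0 mulrBr.
- exact: continuous_subspaceT.
- split.
  + by move=> s _; case: (dF s).
  + by apply: cvg_at_right_filter; exact: cF.
  + by apply: cvg_at_left_filter; exact: cF.
- by move=> s _; rewrite derive1E; case: (dF s).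
Qed.

(** Measured with the weight [expR (2 * L * t)], integrating [L * |u|] halves
    the size of [u]: the antiderivative of the weight brings a factor
    [(2 * L)^-1]. The factor does not depend on the length of the interval, so
    neither Picard iteration nor uniqueness needs a subdivision of [0, T]. *)
Lemma weighted_integral_contraction (R : realType) (L B t : R) (g : R -> R) :
  0 < L -> 0 <= B -> 0 <= t ->
  (@lebesgue_measure R).-integrable `[0, t] (EFin \o g) ->
  (forall s, s \in `[0, t] -> `|g s| <= L * (B * expR (2 * L * s))) ->
  `|\int[@lebesgue_measure R]_(s in `[0, t]) g s| <= B / 2 * expR (2 * L * t).
Proof.
move=> L0 B0 t0 ig gB.
apply: le_trans (le_normr_Rintegral _ ig) _ => //.
apply: (@le_trans _ _ (B / 2 * (expR (2 * L * t) - 1))); last first.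
  by rewrite ler_wpM2l ?divr_ge0// gerBl.
rewrite -integral_exp_weight//; apply: le_Rintegral => //.
- exact: integrable_norm ig.
- exact/continuous_integrable_segment/continuous_exp_weight.
Qed.

Lemma halving_le0 (R : realType) (x C : R) :
  (forall k, x <= C * 2^-1 ^+ k) -> x <= 0.
Proof.
move=> xC.
have h : (fun k => C * 2^-1 ^+ k) @ \oo --> (C * 0 : R).
  by apply: cvgMl_tmp; apply: cvg_expr; rewrite ger0_norm ?invf_lt1 ?ltr1n.
rewrite mulr0 in h.
rewrite -(cvg_lim _ h)//; apply: limr_ge; first by apply/cvg_ex; exists 0.
exact: nearW.
Qed.

(** The weighted contraction can be applied to [u] again and again, which
    bounds it by [M * 2^-k] times the weight for every [k]. *)
Lemma gronwall_uniqueness (R : realType) (L T : R) (g u : R -> R) :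
  0 < L ->
  (@lebesgue_measure R).-integrable `[0, T] (EFin \o g) ->
  {within `[0, T], continuous u} ->
  (forall t, t \in `[0, T] ->
    u t = \int[@lebesgue_measure R]_(s in `[0, t]) g s) ->
  (forall t, t \in `[0, T] -> `|g t| <= L * `|u t|) ->
  forall t, t \in `[0, T] -> u t = 0.
Proof.
move=> L0 ig cu uE gu t0 t0T.
have T0 : 0 <= T by move: t0T; rewrite in_itv/= => /andP[]; exact: le_trans.
have [M M0 uM] : exists2 M : R, 0 <= M &
    forall t, t \in `[0, T] -> `|u t| <= M.
  have [c _ cM] : exists2 c, c \in `[0, T] & forall t, t \in `[0, T] ->
      `|u t| <= `|u c|.
    apply: (@EVT_max _ (fun t => `|u t|)) => // x.
    by apply: (continuous_comp (cu x)); exact: norm_continuous.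
  by exists `|u c|.
have key k t : t \in `[0, T] -> `|u t| <= M * 2^-1 ^+ k * expR (2 * L * t).
  elim: k t => [|k IH] t tT; rewrite in_itv/= in tT; have /andP[t0' tT'] := tT.
    rewrite expr0 mulr1 (le_trans (uM _ tT))// ler_peMr//.
    rewrite (le_trans _ (expR_ge1Dx _))// lerDl mulr_ge0// mulr_ge0//.
    exact: ltW.
  rewrite uE// exprSr mulrA.
  apply: weighted_integral_contraction => //.
  - by rewrite mulr_ge0// exprn_ge0// invr_ge0.
  - exact: integrable_prefix ig.
  - move=> s; rewrite in_itv/= => /andP[s0 st].
    have sT : s \in `[0, T] by rewrite in_itv/= s0 (le_trans st).
    by rewrite (le_trans (gu _ sT))// ler_wpM2l ?IH// ltW.
apply/eqP; rewrite -normr_le0.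
apply: (@halving_le0 _ _ (M * expR (2 * L * t0))) => k.
by rewrite mulrAC key.
Qed.

(** * Projection on a segment *)

(** The projection is used both in space, to truncate the drift, and in time,
    to turn functions known on [0, T] into continuous functions on the line. *)
Definition clamp (R : realType) (lo hi x : R) : R := Num.max lo (Num.min x hi).

Lemma clamp_ge (R : realType) (lo hi x : R) : lo <= clamp lo hi x.
Proof. by rewrite /clamp le_max lexx. Qed.

Lemma clamp_le (R : realType) (lo hi x : R) : lo <= hi -> clamp lo hi x <= hi.
Proof. by move=> lohi; rewrite /clamp ge_max lohi ge_min lexx orbT. Qed.

Lemma clamp_id (R : realType) (lo hi x : R) :
  lo <= x -> x <= hi -> clamp lo hi x = x.
Proof. by move=> lox xhi; rewrite /clamp (min_idPl xhi) (max_idPr lox). Qed.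

Lemma clamp_in (R : realType) (lo hi x : R) : lo <= hi ->
  clamp lo hi x \in `[lo, hi].
Proof. by move=> h; rewrite in_itv/= clamp_ge clamp_le. Qed.

Lemma clamp_nonexpansive (R : realType) (lo hi x y : R) : lo <= hi ->
  `|clamp lo hi x - clamp lo hi y| <= `|x - y|.
Proof.
move=> lohi; wlog xy : x y / x <= y => [h|].
  have [xy|/ltW yx] := leP x y; first exact: h.
  by rewrite distrC (distrC x) h.
rewrite distrC (distrC x) (ger0_norm (_ : 0 <= y - x)) ?subr_ge0//.
rewrite /clamp.
have [?|?] := leP x hi; have [?|?] := leP y hi;
  case: (leP lo x) => ?; case: (leP lo y) => ?; case: (leP lo hi) => ?;
  by rewrite ler_norml; lra.
Qed.

Lemma continuous_clamp (R : realType) (lo hi : R) : lo <= hi ->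
  continuous (clamp lo hi).
Proof.
move=> lohi x; apply/cvgrPdist_lt => e e0; near=> y.
apply: le_lt_trans (clamp_nonexpansive _ _ lohi) _.
by near: y; exact: cvgr_dist_lt.
Unshelve. all: by end_near. Qed.

Lemma continuous_comp_within (X Y U : topologicalType) (A : set Y)
    (c : X -> Y) (h : Y -> U) :
  continuous c -> (forall x, A (c x)) -> {within A, continuous h} ->
  continuous (h \o c).
Proof.
move=> cc cA /subspace_continuousP ch x.
move=> V /(ch _ (cA x)) hV.
have {}hV : nbhs (c x) (fun y => A y -> V (h y)) by exact: hV.
have {}hV : nbhs x (fun y => A (c y) -> V (h (c y))) by exact: cc hV.
by apply: (@filterS _ (nbhs x) _ _ _ _ hV) => y /(_ (cA y)).
Qed.

(** * Picard iteration *)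

(** The intervals of center [a k] and radius [2 * C * 2^-k] are nested; [l] is
    the supremum of their left ends. *)
Lemma geometric_cauchy_limit (R : realType) (a : nat -> R) (C : R) :
  (forall k, `|a k.+1 - a k| <= C * 2^-1 ^+ k) ->
  exists l, forall k, `|a k - l| <= 2 * C * 2^-1 ^+ k.
Proof.
move=> aC; pose r k : R := 2 * C * 2^-1 ^+ k.
have rS k : r k.+1 = r k - C * 2^-1 ^+ k by rewrite /r exprS; lra.
have C0 : 0 <= C by have := le_trans (normr_ge0 _) (aC 0%N); rewrite mulr1.
have r0 k : 0 <= r k by rewrite /r !mulr_ge0// exprn_ge0// invr_ge0.
have up : {homo (fun k => a k - r k) : m n / (m <= n)%N >-> m <= n}.
  apply: homo_leq => //; first exact: le_trans.
  by move=> k; have := aC k; rewrite rS ler_norml; lra.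
have dn : {homo (fun k => a k + r k) : m n / (m <= n)%N >-> n <= m}.
  apply: homo_leq => //; first by move=> x y z h1 h2; exact: le_trans h2 h1.
  by move=> k; have := aC k; rewrite rS ler_norml; lra.
have ub j k : a j - r j <= a k + r k.
  have h1 := up _ _ (leq_maxl j k); have h2 := dn _ _ (leq_maxr j k).
  by have := r0 (maxn j k); lra.
pose S := range (fun k => a k - r k).
have S0 : S !=set0 by exists (a 0%N - r 0%N), 0%N.
have hS : has_sup S.
  by split => //; exists (a 0%N + r 0%N) => _ [k _ <-].
exists (sup S) => k; rewrite -/(r k).
have h1 : a k - r k <= sup S by apply: ub_le_sup; [case: hS|exists k].
have h2 : sup S <= a k + r k by apply: ge_sup => // _ [j _ <-].
by rewrite ler_norml; lra.
Qed.

Lemma continuous_uniform_approx (R : realType) (y : R -> R) (Y : nat -> R -> R)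
    (C : R) :
  (forall k, continuous (Y k)) ->
  (forall k t, `|Y k t - y t| <= C * 2^-1 ^+ k) -> continuous y.
Proof.
move=> cY YC t; apply/cvgrPdist_lt => e e0.
have [k kC] : exists k, C * 2^-1 ^+ k < e / 3.
  have h : (fun k => C * 2^-1 ^+ k) @ \oo --> (C * 0 : R).
    by apply: cvgMl_tmp; apply: cvg_expr; rewrite ger0_norm ?invf_lt1 ?ltr1n.
  rewrite mulr0 in h.
  have e30 : 0 < e / 3 by lra.
  have [N _ hN] := cvgr_lt _ h _ e30.
  by exists N; apply: hN => /=.
near=> s.
have h1 := YC k t; have h2 := YC k s.
have h3 : `|Y k t - Y k s| < e / 3.
  near: s; apply: cvgr_dist_lt; last by lra.
  exact: cY.
move: h1 h2 h3; rewrite !ler_norml !ltr_norml; lra.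
Unshelve. all: by end_near. Qed.

(** Clamping the upper bound of the integral makes the iterates continuous on
    the whole line, so that they can be fed again to [f]. *)
Definition picard_step (R : realType) (T y0 : R) (f : R -> R -> R)
    (z y : R -> R) (t : R) : R :=
  y0 + \int[@lebesgue_measure R]_(s in `[0, clamp 0 T t]) f s (y s) + z t.

Lemma continuous_picard_step (R : realType) (T y0 : R) (f : R -> R -> R)
    (z y : R -> R) :
  0 <= T -> continuous (fun s => f s (y s)) -> continuous z ->
  continuous (picard_step T y0 f z y).
Proof.
move=> T0 cf cz t; apply: cvgD; last exact: cz.
apply: cvgD; first exact: cvg_cst.
have ci := parameterized_integral_continuous T0
  (continuous_integrable_segment 0 T cf).
apply: (continuous_comp_within (continuous_clamp T0) _ ci).
by move=> x; exact: clamp_in.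
Qed.

Lemma picard_step_contraction (R : realType) (L T y0 B : R) (f : R -> R -> R)
    (z y1 y2 : R -> R) :
  0 < L -> 0 <= B ->
  (forall s x y, `|f s x - f s y| <= L * `|x - y|) ->
  continuous (fun s => f s (y1 s)) -> continuous (fun s => f s (y2 s)) ->
  (forall t, t \in `[0, T] -> `|y1 t - y2 t| <= B * expR (2 * L * t)) ->
  forall t, t \in `[0, T] ->
    `|picard_step T y0 f z y1 t - picard_step T y0 f z y2 t|
      <= B / 2 * expR (2 * L * t).
Proof.
move=> L0 B0 lip c1 c2 y12 t; rewrite in_itv/= => /andP[t0 tT].
rewrite /picard_step clamp_id//.
set I1 := Rintegral _ _ _; set I2 := Rintegral _ _ _.
have -> : y0 + I1 + z t - (y0 + I2 + z t) = I1 - I2 by ring.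
rewrite /I1 /I2 -RintegralB//; try exact: continuous_integrable_segment.
apply: weighted_integral_contraction => //.
  apply: continuous_integrable_segment => s; apply: cvgB; [exact: c1|exact: c2].
move=> s; rewrite in_itv/= => /andP[s0 st].
have sT : s \in `[0, T] by rewrite in_itv/= s0 (le_trans st).
by rewrite (le_trans (lip _ _ _))// ler_wpM2l ?y12// ltW.
Qed.

(** Successive iterates differ by at most [M * 2^-k] times the weight, so they
    converge uniformly on [0, T]; the step is a contraction, hence the limit is
    one of its fixed points. *)
Lemma picard_existence (R : realType) (L T y0 : R) (f : R -> R -> R)
    (z : R -> R) :
  0 < L -> 0 <= T ->
  (forall y, continuous y -> continuous (fun s => f s (y s))) ->
  (forall s x y, `|f s x - f s y| <= L * `|x - y|) ->
  continuous z ->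
  exists2 y : R -> R, continuous y & forall t, t \in `[0, T] ->
    y t = y0 + \int[@lebesgue_measure R]_(s in `[0, t]) f s (y s) + z t.
Proof.
move=> L0 T0 cf lip cz.
pose Phi := picard_step T y0 f z; pose Y k := iter k Phi z.
have cY k : continuous (Y k).
  by elim: k => [|k IH] //; apply: continuous_picard_step => //; exact: cf.
have [M M0 YM] : exists2 M : R, 0 <= M &
    forall t, t \in `[0, T] -> `|Y 1%N t - Y 0%N t| <= M.
  have [c _ cM] : exists2 c, c \in `[0, T] & forall t, t \in `[0, T] ->
      `|Y 1%N t - Y 0%N t| <= `|Y 1%N c - Y 0%N c|.
    apply: (@EVT_max _ (fun t => `|Y 1%N t - Y 0%N t|)) => //.
    apply: continuous_subspaceT => x; apply: cvg_norm.
    by apply: cvgB; [exact: (cY 1%N)|exact: (cY 0%N)].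
  by exists `|Y 1%N c - Y 0%N c|.
have half0 k : 0 <= (2^-1 : R) ^+ k by rewrite exprn_ge0 ?invr_ge0.
have step k t : t \in `[0, T] ->
    `|Y k.+1 t - Y k t| <= M * 2^-1 ^+ k * expR (2 * L * t).
  elim: k t => [|k IH] t tT.
    rewrite expr0 mulr1 (le_trans (YM _ tT))// ler_peMr//.
    have t0 : 0 <= t by move: tT; rewrite in_itv/= => /andP[].
    by rewrite (le_trans _ (expR_ge1Dx _))// lerDl !mulr_ge0// ltW.
  rewrite exprSr mulrA /Y !iterS.
  apply: (picard_step_contraction y0 z L0 _ lip (cf _ (cY k.+1))
    (cf _ (cY k)) IH) => //.
  by rewrite mulr_ge0.
have /choice[y yP] t : exists l, forall k, `|Y k (clamp 0 T t) - l| <=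
    2 * (M * expR (2 * L * clamp 0 T t)) * 2^-1 ^+ k.
  by apply: geometric_cauchy_limit => k; rewrite mulrAC step// clamp_in.
have cy : continuous y.
  apply: (@continuous_uniform_approx _ _ (fun k => Y k \o clamp 0 T)
    (2 * (M * expR (2 * L * T)))).
    move=> k t; apply: continuous_comp; last exact: cY.
    exact: continuous_clamp.
  move=> k t; rewrite (le_trans (yP _ _))// ler_wpM2r// !ler_wpM2l//.
  by rewrite ler_expR ler_wpM2l ?clamp_le// mulr_ge0// ltW.
exists y => // t tT; have := tT; rewrite in_itv/= => /andP[t0 tT'].
apply/eqP; rewrite -subr_eq0 -normr_le0.
have -> : y t - (y0 + \int[@lebesgue_measure R]_(s in `[0, t]) f s (y s) + z t)
    = y t - Phi y t by rewrite /Phi /picard_step clamp_id.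
apply: (@halving_le0 _ _ (2 * M * expR (2 * L * t))) => k.
have yY j s : s \in `[0, T] ->
    `|Y j s - y s| <= 2 * M * 2^-1 ^+ j * expR (2 * L * s).
  move=> sT; have := yP s j; move: sT; rewrite in_itv/= => /andP[s0 sT].
  rewrite clamp_id//.
  by have -> : 2 * M * 2^-1 ^+ j * expR (2 * L * s) =
    2 * (M * expR (2 * L * s)) * 2^-1 ^+ j by ring.
have h1 := yY k.+1 _ tT.
have h2 : `|Y k.+1 t - Phi y t| <= 2 * M * 2^-1 ^+ k / 2 * expR (2 * L * t).
  apply: (picard_step_contraction y0 z L0 _ lip (cf _ (cY k)) (cf _ cy)
    (yY k)) => //.
  by rewrite !mulr_ge0.
have -> : 2 * M * expR (2 * L * t) * 2^-1 ^+ k =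
  2 * M * 2^-1 ^+ k.+1 * expR (2 * L * t) +
  2 * M * 2^-1 ^+ k / 2 * expR (2 * L * t) by rewrite exprS; field.
move: h1 h2; rewrite !ler_norml; lra.
Qed.

(** * Convergence of the Euler scheme *)

Lemma heine_segment (R : realType) (T e : R) (g : R -> R) :
  continuous g -> 0 < e ->
  exists2 d, 0 < d & forall s t, s \in `[0, T] -> `|s - t| < d ->
    `|g s - g t| < e.
Proof.
move=> cg e0.
have := @segment_compact R 0 T => /compact_near_coveringP/(_ R (0^'+)
  (fun d x => forall t, `|x - t| < d -> `|g x - g t| < e) _) [].
  move=> x _; have e20 : 0 < e / 2 by lra.
  have /cvgrPdist_lt/(_ _ e20)/nbhs_ballP[r /= r0 hr] := cg x.
  exists (ball x (r / 2), [set d | d < r / 2]) => /=.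
    split; first by apply: nbhsx_ballx; lra.
    by apply: nbhs_right_lt; lra.
  move=> [x' d]/= [xx' dr] t x't.
  have h1 : `|g x - g x'| < e / 2.
    by apply: hr; apply: (le_ball _ xx'); lra.
  have h2 : `|g x - g t| < e / 2.
    apply: hr; move: xx' x't; rewrite /ball/= !ltr_norml; lra.
  by move: h1 h2; rewrite !ltr_norml; lra.
move=> r /= r0 hr; exists (r / 2); first by lra.
move=> s t sT; apply: (hr (r / 2)) => //=; last by lra.
by rewrite sub0r normrN gtr0_norm; lra.
Qed.

(** The bound is required on the half-open interval only: at the last time
    spent above a level, just the later times are under control. *)
Lemma integral_increment_ge (R : realType) (T c a b : R) (g : R -> R) :
  (@lebesgue_measure R).-integrable `[0, T] (EFin \o g) ->
  0 <= a -> a <= b -> b <= T ->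
  (forall s, a < s -> s <= b -> c <= g s) ->
  c * (b - a) <= \int[@lebesgue_measure R]_(s in `[0, b]) g s -
                 \int[@lebesgue_measure R]_(s in `[0, a]) g s.
Proof.
move=> ig a0 ab bT cg.
have ib := integrable_prefix bT ig.
rewrite Rintegral_itvB ?bnd_simp//.
have -> : c * (b - a) = \int[@lebesgue_measure R]_(s in `]a, b]) c.
  rewrite Rintegral_cst//; congr (_ * _).
  have := @lebesgue_measure_itv R `]a, b]; rewrite /= lte_fin -EFinD => h.
  apply: esym; transitivity (fine (if a < b then (b - a)%:E else 0%E)).
    by rewrite -h.
  by case: ltP => // ba; rewrite /=; lra.
apply: le_Rintegral => //.
- have ic := continuous_integrable_segment a b (@cst_continuous _ _ c).
  apply: integrableS ic => //.
  by apply: subset_itvr; rewrite bnd_simp.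
- apply: integrableS ib => //.
  by apply: subset_itvr; rewrite bnd_simp.
- by move=> s /=; rewrite in_itv/= => /andP[? ?]; exact: cg.
Qed.

Lemma integral_increment_le (R : realType) (T c a b : R) (g : R -> R) :
  (@lebesgue_measure R).-integrable `[0, T] (EFin \o g) ->
  0 <= a -> a <= b -> b <= T ->
  (forall s, a < s -> s <= b -> g s <= c) ->
  \int[@lebesgue_measure R]_(s in `[0, b]) g s -
  \int[@lebesgue_measure R]_(s in `[0, a]) g s <= c * (b - a).
Proof.
move=> ig a0 ab bT cg.
have ib := integrable_prefix bT ig.
rewrite Rintegral_itvB ?bnd_simp//.
have -> : c * (b - a) = \int[@lebesgue_measure R]_(s in `]a, b]) c.
  rewrite Rintegral_cst//; congr (_ * _).
  have := @lebesgue_measure_itv R `]a, b]; rewrite /= lte_fin -EFinD => h.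
  apply: esym; transitivity (fine (if a < b then (b - a)%:E else 0%E)).
    by rewrite -h.
  by case: ltP => // ba; rewrite /=; lra.
apply: le_Rintegral => //.
- apply: integrableS ib => //.
  by apply: subset_itvr; rewrite bnd_simp.
- have ic := continuous_integrable_segment a b (@cst_continuous _ _ c).
  apply: integrableS ic => //.
  by apply: subset_itvr; rewrite bnd_simp.
- by move=> s /=; rewrite in_itv/= => /andP[? ?]; exact: cg.
Qed.

Fixpoint euler (R : realType) (f : R -> R -> R) (z : R -> R) (y0 h : R)
    (k : nat) : R :=
  if k is j.+1 then
    euler f z y0 h j + f (j%:R * h) (euler f z y0 h j) * h +
    (z (j.+1%:R * h) - z (j%:R * h))
  else y0 + z 0.

(** One step multiplies the error by [1 + L * h <= expR (L * h)] and adds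
    [h * eta], where [eta] bounds the variation of the drift along the exact
    solution during a step. *)
Lemma euler_error (R : realType) (L T y0 h eta : R) (f : R -> R -> R)
    (z y : R -> R) (m : nat) :
  0 < L -> 0 <= h -> 0 <= eta -> m%:R * h <= T ->
  (forall s x y, `|f s x - f s y| <= L * `|x - y|) ->
  (@lebesgue_measure R).-integrable `[0, T] (EFin \o (fun s => f s (y s))) ->
  (forall t, t \in `[0, T] ->
    y t = y0 + \int[@lebesgue_measure R]_(s in `[0, t]) f s (y s) + z t) ->
  (forall k s, (k < m)%N -> k%:R * h < s -> s <= k.+1%:R * h ->
    `|f (k%:R * h) (y (k%:R * h)) - f s (y s)| <= eta) ->
  forall k, (k <= m)%N -> `|euler f z y0 h k - y (k%:R * h)| <=
    expR (L * (k%:R * h)) * (k%:R * h) * eta.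
Proof.
move=> L0 h0 eta0 mT lip ig yE fy.
elim=> [_|k IH km].
  have T0 : 0 <= T by apply: le_trans mT; rewrite mulr_ge0.
  rewrite !mul0r mulr0 mul0r /= yE ?in_itv/= ?lexx//.
  by rewrite set_itv1 Rintegral_set1 addr0 subrr normr0.
have {}IH := IH (ltnW km).
set a := k%:R * h in IH *; set b := k.+1%:R * h.
have ab : b = a + h by rewrite /a /b -natr1; ring.
have a0 : 0 <= a by rewrite mulr_ge0.
have bT : b <= T by apply: le_trans mT; rewrite ler_wpM2r// ler_nat.
have hg s : a < s -> s <= b -> `|f a (y a) - f s (y s)| <= eta.
  exact: fy.
have lo : (f a (y a) - eta) * (b - a) <=
    \int[@lebesgue_measure R]_(s in `[0, b]) f s (y s) -
    \int[@lebesgue_measure R]_(s in `[0, a]) f s (y s).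
  apply: integral_increment_ge ig _ _ _ _ => //; first lra.
  by move=> s a_s sb; have := hg _ a_s sb; rewrite ler_norml; lra.
have hi : \int[@lebesgue_measure R]_(s in `[0, b]) f s (y s) -
    \int[@lebesgue_measure R]_(s in `[0, a]) f s (y s) <=
    (f a (y a) + eta) * (b - a).
  apply: integral_increment_le ig _ _ _ _ => //; first lra.
  by move=> s a_s sb; have := hg _ a_s sb; rewrite ler_norml; lra.
have ya := yE a; have yb := yE b.
rewrite !in_itv/= in ya yb.
have {}ya := ya ltac:(apply/andP; split; lra).
have {}yb := yb ltac:(apply/andP; split; lra).
set Ib := Rintegral _ _ _ in lo hi yb; set Ia := Rintegral _ _ _ in lo hi ya.
rewrite /= -/a -/b; set X := euler _ _ _ _ _ in IH *.
have l1 := lip a X (y a).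
set e := `|X - y a| in IH l1 *.
have l2 : `|f a X - f a (y a)| * h <= L * e * h by exact: ler_wpM2r.
have bah : b - a = h by lra.
rewrite bah in lo hi.
have e1 : `|X + f a X * h + (z b - z a) - y b| <= (1 + L * h) * e + eta * h.
  have -> : X + f a X * h + (z b - z a) - y b =
      (X - y a) + (f a X - f a (y a)) * h + (f a (y a) * h - (Ib - Ia)).
    by rewrite ya yb; ring.
  have t1 : `|f a (y a) * h - (Ib - Ia)| <= eta * h.
    by rewrite ler_norml; move: lo hi; rewrite mulrBl mulrDl; lra.
  apply: le_trans (ler_normD _ _) _; apply: le_trans (lerD _ t1) _.
    apply: le_trans (ler_normD _ _) _; apply: lerD (lexx _) _.
    rewrite normrM (ger0_norm h0); exact: l2.
  by rewrite -/e; lra.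
apply: le_trans e1 _.
have x1 : 1 + L * h <= expR (L * h) by exact: expR_ge1Dx.
have xb : expR (L * b) = expR (L * h) * expR (L * a).
  by rewrite -expRD; congr expR; rewrite ab; ring.
have e0 : 0 <= e by exact: normr_ge0.
have s1 : (1 + L * h) * e <= expR (L * h) * (expR (L * a) * a * eta).
  apply: ler_pM => //; by rewrite addr_ge0// mulr_ge0// ltW.
have s2 : eta * h <= expR (L * b) * (eta * h).
  rewrite ler_peMl ?mulr_ge0//.
  by rewrite (le_trans _ (expR_ge1Dx _))// lerDl mulr_ge0 ?(ltW L0)//; lra.
rewrite {2}ab mulrDr mulrDl xb; move: s2; rewrite xb; lra.
Qed.

(** Subdividing [0, t], with [t] itself as the last node, spares any
    interpolation between nodes. *)
Lemma euler_cvg (R : realType) (L T y0 : R) (f : R -> R -> R)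
    (z y : R -> R) :
  0 < L ->
  (forall s x y, `|f s x - f s y| <= L * `|x - y|) ->
  continuous (fun s => f s (y s)) ->
  (forall t, t \in `[0, T] ->
    y t = y0 + \int[@lebesgue_measure R]_(s in `[0, t]) f s (y s) + z t) ->
  forall t, t \in `[0, T] ->
    (fun m => euler f z y0 (t / m.+1%:R) m.+1) @ \oo --> y t.
Proof.
move=> L0 lip cf yE t tT; have := tT; rewrite in_itv/= => /andP[t0 tT'].
apply/cvgrPdist_lt => e e0.
pose C := expR (L * t) * t.
have C0 : 0 <= C by rewrite mulr_ge0// expR_ge0.
pose eta := e / (C + 1).
have eta0 : 0 < eta by rewrite divr_gt0//; lra.
have Ceta : C * eta < e.
  by rewrite /eta mulrA ltr_pdivrMr; nra.
have [d d0 hd] := heine_segment T cf eta0.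
have hm : (fun m => t * harmonic m) @ \oo --> (t * 0 : R).
  by apply: cvgMl_tmp; exact: cvg_harmonic.
rewrite mulr0 in hm.
near=> m.
have md : t / m.+1%:R < d by near: m; exact: (cvgr_lt _ hm).
set h := t / m.+1%:R in md *.
have h0 : 0 <= h by rewrite divr_ge0.
have mh : m.+1%:R * h = t by rewrite mulrC divfK// pnatr_eq0.
have mhT : m.+1%:R * h <= T by rewrite mh.
have err := euler_error L0 h0 (ltW eta0) mhT lip
  (continuous_integrable_segment 0 T cf) yE.
have {}err : `|euler f z y0 h m.+1 - y t| <= C * eta.
  rewrite /C -[in y t]mh -[in L * t]mh -[X in _ * X * eta]mh.
  apply: err => // k s km ks sk; apply/ltW/hd.
    rewrite in_itv/= mulr_ge0//= (le_trans _ tT')// -mh ler_wpM2r// ler_nat.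
    exact: ltnW.
  apply: le_lt_trans md; rewrite ler_norml; move: sk; rewrite -natr1; lra.
by rewrite distrC; exact: le_lt_trans err Ceta.
Unshelve. all: by end_near. Qed.

(** * The barrier argument *)

(** If [u t <= e], consider the last time before [t] at which [u >= 2 * e].
    The growth hypothesis then applies from that time to [t], where [u] has
    lost at least [e]; this contradicts the inequality between [A], [K] and
    [e]. *)
Lemma barrier_not_crossed (R : realType) (T lambda A K e : R) (u : R -> R) :
  0 < e -> continuous u -> 2 * e <= u 0 ->
  (forall x, 0 <= x -> K * x `^ lambda < A * x + e) ->
  (forall s t, 0 <= s -> s <= t -> t <= T ->
    (forall r, s < r -> r <= t -> u r <= 2 * e) ->
    A * (t - s) - K * (t - s) `^ lambda <= u t - u s) ->
  forall t, t \in `[0, T] -> e < u t.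
Proof.
move=> e0 cu u0 AK low t; rewrite in_itv/= => /andP[t0 tT].
rewrite ltNge; apply/negP => ut.
pose S := `[0, t] `&` [set s | 2 * e <= u s].
have S0 : S 0 by split; rewrite //= in_itv/= lexx.
have St s : S s -> s <= t by case=> /=; rewrite in_itv/= => /andP[].
have ubS : has_ubound S by exists t => s /St.
have cS : closed S.
  apply: closedI; first exact: itv_closed.
  apply: (@closed_comp _ _ u [set x | 2 * e <= x]); last exact: closed_ge.
  by move=> x _; exact: cu.
have [/=] : S (sup S).
  have : closure S (sup S) by apply: closure_sup => //; exists 0.
  by rewrite -((closure_id S).1 cS).
rewrite in_itv/= => /andP[s0 st] us.
have /low : forall r, sup S < r -> r <= t -> u r <= 2 * e.
  move=> r sr rt; rewrite leNgt; apply/negP => ur.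
  have : r <= sup S.
    apply: ub_le_sup => //; split=> /=; last exact: ltW.
    by rewrite in_itv/= rt andbT; lra.
  lra.
move=> /(_ s0 st tT).
have := AK (t - sup S); rewrite subr_ge0 => /(_ st); lra.
Qed.

(** An inequality [c / (2 * e)^gamma * x + e <= K * x^lambda] would give
    [e <= K * x^lambda] and [c * x^(1 - lambda) <= K * (2 * e)^gamma].
    Eliminating [x] leaves [c * (e / K)^p <= K * (2 * e)^gamma] with
    [p = (1 - lambda) / lambda], a lower bound for [e^(gamma - p)], hence for
    [e] since [p < gamma]. *)
Lemma holder_loses_to_singular_drift (R : realType) (lambda gamma c K : R) :
  0 < lambda -> lambda < 1 -> 0 < c -> 0 < K ->
  (1 - lambda) / lambda < gamma ->
  exists2 e0, 0 < e0 & forall e, 0 < e -> e <= e0 -> forall x, 0 <= x ->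
    K * x `^ lambda < c / (2 * e) `^ gamma * x + e.
Proof.
move=> l0 l1 c0 K0; set p := (1 - lambda) / lambda => pg.
have p0 : 0 < p by rewrite divr_gt0// subr_gt0.
have q0 : 0 < gamma - p by lra.
have K20 : 0 < K * 2 `^ gamma by rewrite mulr_gt0// powR_gt0.
(* Half of the lower bound that a violation would impose on e^(gamma - p). *)
pose D := c * K^-1 `^ p / (2 * (K * 2 `^ gamma)).
have cK0 : 0 < c * K^-1 `^ p by rewrite mulr_gt0// powR_gt0// invr_gt0.
have D0 : 0 < D by rewrite divr_gt0// mulr_gt0.
exists (D `^ (gamma - p)^-1); first exact: powR_gt0.
move=> e e0 eD x; rewrite le_eqVlt => /predU1P[<-|x0].
  by rewrite powR0 ?gt_eqF// !mulr0 add0r.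
have eD' : e `^ (gamma - p) <= D.
  have -> : D = (D `^ (gamma - p)^-1) `^ (gamma - p).
    by rewrite -powRrM mulVf ?powRr1 ?ltW ?gt_eqF.
  by apply: ge0_ler_powR; rewrite ?nnegrE ?powR_ge0//; exact: ltW.
rewrite ltNge; apply/negP => H.
have g0 : 0 < (2 * e) `^ gamma by rewrite powR_gt0//; lra.
have xl0 : 0 < x `^ lambda by exact: powR_gt0.
have cg0 : 0 < c / (2 * e) `^ gamma * x by rewrite mulr_gt0// divr_gt0.
have h1 : e / K <= x `^ lambda by rewrite ler_pdivrMr// mulrC; lra.
have h2 : c * x `^ (1 - lambda) <= K * (2 * e) `^ gamma.
  have : c / (2 * e) `^ gamma * x <= K * x `^ lambda by lra.
  rewrite mulrAC ler_pdivrMr// -{1}(powRr1 (ltW x0)).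
  rewrite -{1}(subrK lambda 1) powRD ?(gt_eqF x0) ?implybT// mulrA.
  by rewrite (mulrAC K) ler_pM2r.
have h3 : (e / K) `^ p <= x `^ (1 - lambda).
  have -> : x `^ (1 - lambda) = (x `^ lambda) `^ p.
    by rewrite -powRrM /p mulrC divfK// gt_eqF.
  have eK0 : 0 <= e / K by rewrite divr_ge0// ltW.
  by apply: ge0_ler_powR; rewrite ?nnegrE ?powR_ge0//; exact: ltW.
have h4 : c * (e / K) `^ p <= K * (2 * e) `^ gamma.
  by apply: le_trans h2; rewrite ler_pM2l.
have Ki0 : 0 <= K^-1 by rewrite invr_ge0 ltW.
move: h4; rewrite (powRM _ (ltW e0) Ki0) (powRM gamma _ (ltW e0))//.
have -> : e `^ gamma = e `^ (gamma - p) * e `^ p.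
  by rewrite -powRD ?subrK// (gt_eqF e0) implybT.
have ep0 : 0 < e `^ p by exact: powR_gt0.
rewrite (mulrC (e `^ p)) !mulrA ler_pM2r//.
apply/negP; rewrite -ltNge.
apply: (@le_lt_trans _ _ (K * 2 `^ gamma * D)); first by rewrite ler_pM2l.
have -> : K * 2 `^ gamma * D = c * K^-1 `^ p / 2.
  by rewrite /D; field; rewrite !gt_eqF// powR_gt0.
lra.
Qed.

Lemma holder_bound_continuous (R : realType) (T lambda K : R) (g : R -> R) :
  0 <= T -> 0 < lambda -> holder_bound T lambda K g ->
  continuous (g \o clamp 0 T).
Proof.
move=> T0 l0 hg x; apply/cvgrPdist_lt => e e0.
pose K' := `|K| + 1.
have K'0 : 0 < K' by rewrite /K'; have := normr_ge0 K; lra.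
have d0 : 0 < (e / K') `^ lambda^-1 by rewrite powR_gt0// divr_gt0.
near=> y.
have xy : `|x - y| < (e / K') `^ lambda^-1.
  near: y; apply: (@cvgr_dist_lt _ _ _ _ _ id) => //; exact: cvg_id.
apply: le_lt_trans (hg _ _ (clamp_in _ T0) (clamp_in _ T0)) _.
have h1 : `|clamp 0 T x - clamp 0 T y| `^ lambda < e / K'.
  have -> : e / K' = ((e / K') `^ lambda^-1) `^ lambda.
    by rewrite -powRrM mulVf ?gt_eqF// powRr1// ltW// divr_gt0.
  apply: gt0_ltr_powR; rewrite ?nnegrE ?powR_ge0//.
  exact: le_lt_trans (clamp_nonexpansive _ _ T0) xy.
move: h1; rewrite ltr_pdivlMr// mulrC; apply: le_lt_trans.
rewrite ler_wpM2r ?powR_ge0// /K'.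
by have := ler_norm K; lra.
Unshelve. all: by end_near. Qed.

(** * The truncated drift *)

(** Time is clamped as well, so that the truncated drift is globally defined
    and, where the strip has width at least [2 * e], samples [b] at distance at
    least [e] from both boundaries only. *)
Definition truncated_drift (R : realType) (T : R) (phi psi : R -> R)
    (b : R -> R -> R) (e s y : R) : R :=
  let r := clamp 0 T s in b r (clamp (phi r + e) (psi r - e) y).

(** If the strip had width at most [2 * ystar] at some time, its midpoint would
    lie in both explosion zones, and the drift there would be both positive and
    negative. *)
Lemma drift_gap (R : realType) (T gamma ystar c : R) (phi psi : R -> R)
    (b : R -> R -> R) :
  0 < c -> 0 < ystar ->
  (forall t : R, t \in `[0, T] -> phi t < psi t) ->
  (forall t y : R,
    (domain T phi psi 0 0 `\` domain T phi psi ystar 0) (t, y) ->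
    c / (y - phi t) `^ gamma <= b t y) ->
  (forall t y : R,
    (domain T phi psi 0 0 `\` domain T phi psi 0 ystar) (t, y) ->
    b t y <= - (c / (psi t - y) `^ gamma)) ->
  forall t, t \in `[0, T] -> phi t + 2 * ystar < psi t.
Proof.
move=> c0 ystar0 pp lo hi t tT; have ppt := pp _ tT.
move: tT; rewrite in_itv/= => tT.
rewrite ltNge; apply/negP => gap.
pose y := (phi t + psi t) / 2.
have y1 : 0 < y - phi t by rewrite /y; lra.
have y2 : 0 < psi t - y by rewrite /y; lra.
have dom : domain T phi psi 0 0 (t, y).
  by split => //=; rewrite addr0 subr0; apply/andP; split; lra.
have l : c / (y - phi t) `^ gamma <= b t y.
  apply: lo; split => // -[_ /=] /andP[+ _]; rewrite /y; lra.
have h : b t y <= - (c / (psi t - y) `^ gamma).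
  apply: hi; split => // -[_ /=] /andP[_]; rewrite /y; lra.
have l0 : 0 < c / (y - phi t) `^ gamma by rewrite divr_gt0// powR_gt0.
have h0 : 0 < c / (psi t - y) `^ gamma by rewrite divr_gt0// powR_gt0.
lra.
Qed.

(** The Lipschitz hypothesis is about open strips while truncation produces
    boundary points, whence its use with margins [e / 2]. *)
Lemma truncated_drift_lipschitz (R : realType) (T e : R) (phi psi : R -> R)
    (b : R -> R -> R) :
  drift_locally_lipschitz T phi psi b -> 0 <= T -> 0 < e ->
  e < sup_norm T (phi \- psi) ->
  (forall t, t \in `[0, T] -> phi t + 2 * e <= psi t) ->
  exists2 L, 0 < L & forall s x y,
    `|truncated_drift T phi psi b e s x - truncated_drift T phi psi b e s y|
      <= L * `|x - y|.
Proof.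
move=> B2 T0 e0 es gap.
have e20 : 0 < e / 2 by lra.
have [] := B2 _ _ e20 e20; first lra.
move=> L L0 lip; exists L => // s x y; rewrite /truncated_drift.
have rT := clamp_in s T0; set r := clamp 0 T s in rT *.
have g : phi r + e <= psi r - e by have := gap _ rT; lra.
have dom w : domain T phi psi (e / 2) (e / 2)
    (r, clamp (phi r + e) (psi r - e) w).
  split => //=; have := clamp_ge (phi r + e) (psi r - e) w.
  have := clamp_le w g => ? ?; apply/andP; split; lra.
apply: le_trans (lip _ _ _ (dom _) (dom _)) _.
by rewrite ler_pM2l// clamp_nonexpansive.
Qed.

Lemma truncated_drift_continuous (R : realType) (T e : R) (phi psi : R -> R)
    (b : R -> R -> R) (y : R -> R) :
  drift_continuous T phi psi b -> 0 <= T -> 0 < e ->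
  (forall t, t \in `[0, T] -> phi t + 2 * e <= psi t) ->
  continuous (phi \o clamp 0 T) -> continuous (psi \o clamp 0 T) ->
  continuous y ->
  continuous (fun s => truncated_drift T phi psi b e s (y s)).
Proof.
move=> B1 T0 e0 gap cphi cpsi cy.
pose w s := clamp (phi (clamp 0 T s) + e) (psi (clamp 0 T s) - e) (y s).
have cw : continuous w.
  move=> s; rewrite /w {1}/clamp.
  apply: (@continuous_max _ _ (fun s => phi (clamp 0 T s) + e)
    (fun s => Num.min (y s) (psi (clamp 0 T s) - e))).
    by apply: cvgD; [exact: cphi|exact: cvg_cst].
  apply: (@continuous_min _ _ y (fun s => psi (clamp 0 T s) - e)).
    exact: cy.
  by apply: cvgB; [exact: cpsi|exact: cvg_cst].
have cp : continuous (fun s => (clamp 0 T s, w s)).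
  have c1 : continuous (clamp 0 T) by exact: continuous_clamp.
  by move=> s; exact: (cvg_pair (c1 s) (cw s)).
apply: (continuous_comp_within cp _ B1).
move=> s; have rT := clamp_in s T0; split => //=.
have g : phi (clamp 0 T s) + e <= psi (clamp 0 T s) - e.
  by have := gap _ rT; lra.
have := clamp_ge (phi (clamp 0 T s) + e) (psi (clamp 0 T s) - e) (y s).
have := clamp_le (y s) g => ? ?; apply/andP; split; rewrite /w; lra.
Qed.

(** * Confinement of truncated solutions *)

(** Both barriers are handled by [barrier_not_crossed], applied to [y - phi] and
    to [psi - y]. Below [phi + 2 * e] the truncated drift samples [b] at distance
    at most [2 * e <= ystar] from [phi], in the explosion zone of the drift; this
    is why the bounds on [b] apply along the whole excursion below [2 * e]. *)
Lemma truncated_solution_confined (R : realType)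
    (T lambda gamma ystar c e K Kphi Kpsi Kz y0 : R)
    (phi psi z y : R -> R) (b : R -> R -> R) :
  0 <= T -> 0 < lambda -> 0 < gamma -> 0 < c -> 0 < e -> 2 * e <= ystar ->
  holder_bound T lambda Kphi phi -> holder_bound T lambda Kpsi psi ->
  holder_bound T lambda Kz z -> Kz + Kphi <= K -> Kz + Kpsi <= K ->
  z 0 = 0 ->
  (forall t, t \in `[0, T] -> phi t + 2 * ystar < psi t) ->
  2 * e <= y0 - phi 0 -> 2 * e <= psi 0 - y0 ->
  (forall t y : R,
    (domain T phi psi 0 0 `\` domain T phi psi ystar 0) (t, y) ->
    c / (y - phi t) `^ gamma <= b t y) ->
  (forall t y : R,
    (domain T phi psi 0 0 `\` domain T phi psi 0 ystar) (t, y) ->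
    b t y <= - (c / (psi t - y) `^ gamma)) ->
  (forall x, 0 <= x -> K * x `^ lambda < c / (2 * e) `^ gamma * x + e) ->
  continuous y -> continuous (fun s => truncated_drift T phi psi b e s (y s)) ->
  (forall t, t \in `[0, T] -> y t = y0 +
    \int[@lebesgue_measure R]_(s in `[0, t])
      truncated_drift T phi psi b e s (y s) + z t) ->
  forall t, t \in `[0, T] -> phi t + e < y t < psi t - e.
Proof.
move=> T0 l0 g0 c0 e0 ey hphi hpsi hz Kp Kq z0 gap y0phi y0psi Blo Bhi AK cy cf
  yE t tT.
have ig := continuous_integrable_segment 0 T cf.
have cphi := holder_bound_continuous T0 l0 hphi.
have cpsi := holder_bound_continuous T0 l0 hpsi.
have c00 : clamp 0 T 0 = 0 :> R by rewrite clamp_id.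
have z0T : (0 : R) \in `[0, T] by rewrite in_itv/= lexx.
have yz : y 0 = y0 by rewrite yE// set_itv1 Rintegral_set1 z0 !addr0.
have E0 : 0 < (2 * e) `^ gamma by rewrite powR_gt0//; lra.
have sing w : 0 < w -> w <= 2 * e -> c / (2 * e) `^ gamma <= c / w `^ gamma.
  move=> w0 we; have w1 : 0 < w `^ gamma by exact: powR_gt0.
  rewrite ler_pM2l// lef_pV2 ?posrE//.
  by apply: ge0_ler_powR; rewrite ?nnegrE; lra.
have increment s r : 0 <= s -> s <= r -> r <= T ->
    [/\ s \in `[0, T], r \in `[0, T] & y r - y s =
    (\int[@lebesgue_measure R]_(s in `[0, r])
      truncated_drift T phi psi b e s (y s) -
    \int[@lebesgue_measure R]_(s in `[0, s])
      truncated_drift T phi psi b e s (y s)) + (z r - z s)].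
  move=> s0 sr rT.
  have s_T : s \in `[0, T] by rewrite in_itv/=; apply/andP; split; lra.
  have r_T : r \in `[0, T] by rewrite in_itv/=; apply/andP; split; lra.
  by split => //; rewrite yE// (yE s)//; ring.
have inside r : r \in `[0, T] ->
    [/\ phi r + e <= clamp (phi r + e) (psi r - e) (y r),
      clamp (phi r + e) (psi r - e) (y r) <= psi r - e &
      domain T phi psi 0 0 (r, clamp (phi r + e) (psi r - e) (y r))].
  move=> rT; have gr := gap _ rT.
  have v1 := clamp_ge (phi r + e) (psi r - e) (y r).
  have v2 : clamp (phi r + e) (psi r - e) (y r) <= psi r - e.
    by apply: clamp_le; lra.
  split => //; split; first by move: rT; rewrite in_itv.
  by rewrite /= addr0 subr0; apply/andP; split; lra.
have lower : e < y t - phi (clamp 0 T t).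
  apply: (@barrier_not_crossed R T lambda (c / (2 * e) `^ gamma) K e
    (fun t => y t - phi (clamp 0 T t))) => //.
  - by move=> s; apply: cvgB; [exact: cy|exact: cphi].
  - by rewrite c00 yz.
  move=> s r s0 sr rT near_phi.
  have [s_T r_T yrs] := increment _ _ s0 sr rT.
  have := integral_increment_ge ig s0 sr rT (c := c / (2 * e) `^ gamma) _.
  have push q : s < q -> q <= r ->
      c / (2 * e) `^ gamma <= truncated_drift T phi psi b e q (y q).
    move=> sq qr; have q_T : q \in `[0, T].
      by rewrite in_itv/=; apply/andP; split; lra.
    have [qge qle] : 0 <= q /\ q <= T by move: q_T; rewrite in_itv/= => /andP.
    have qc : clamp 0 T q = q by exact: clamp_id.
    have := near_phi _ sq qr; rewrite /truncated_drift qc => yq.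
    have [w1 w2 dw] := inside _ q_T.
    have w3 : clamp (phi q + e) (psi q - e) (y q) <= phi q + 2 * e.
      rewrite /clamp ge_max ge_min; apply/andP; split; first lra.
      by apply/orP; left; lra.
    apply: le_trans (Blo _ _ _); last first.
      by split => // -[_ /=] /andP[+ _]; lra.
    by apply: sing; lra.
  move=> /(_ push) drift.
  have := hz _ _ r_T s_T; have := hphi _ _ r_T s_T.
  rewrite (ger0_norm (_ : 0 <= r - s)) ?subr_ge0//.
  have := powR_ge0 (r - s) lambda; set X := (r - s) `^ lambda => X0.
  have KX : (Kz + Kphi) * X <= K * X by rewrite ler_wpM2r.
  move: s_T r_T; rewrite !in_itv/= => /andP[? ?] /andP[? ?].
  rewrite !clamp_id// !ler_norml; lra.
have upper : e < psi (clamp 0 T t) - y t.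
  apply: (@barrier_not_crossed R T lambda (c / (2 * e) `^ gamma) K e
    (fun t => psi (clamp 0 T t) - y t)) => //.
  - by move=> s; apply: cvgB; [exact: cpsi|exact: cy].
  - by rewrite c00 yz.
  move=> s r s0 sr rT near_psi.
  have [s_T r_T yrs] := increment _ _ s0 sr rT.
  have := integral_increment_le ig s0 sr rT (c := - (c / (2 * e) `^ gamma)) _.
  have push q : s < q -> q <= r ->
      truncated_drift T phi psi b e q (y q) <= - (c / (2 * e) `^ gamma).
    move=> sq qr; have q_T : q \in `[0, T].
      by rewrite in_itv/=; apply/andP; split; lra.
    have [qge qle] : 0 <= q /\ q <= T by move: q_T; rewrite in_itv/= => /andP.
    have qc : clamp 0 T q = q by exact: clamp_id.
    have := near_psi _ sq qr; rewrite /truncated_drift qc => yq.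
    have [w1 w2 dw] := inside _ q_T.
    have w3 : psi q - 2 * e <= clamp (phi q + e) (psi q - e) (y q).
      rewrite /clamp le_max le_min; apply/orP; right.
      by apply/andP; split; lra.
    apply: le_trans (Bhi _ _ _) _.
      by split => // -[_ /=] /andP[_]; lra.
    by rewrite lerN2; apply: sing; lra.
  move=> /(_ push) drift.
  have := hz _ _ r_T s_T; have := hpsi _ _ r_T s_T.
  rewrite (ger0_norm (_ : 0 <= r - s)) ?subr_ge0//.
  have := powR_ge0 (r - s) lambda; set X := (r - s) `^ lambda => X0.
  have KX : (Kz + Kpsi) * X <= K * X by rewrite ler_wpM2r.
  move: s_T r_T; rewrite !in_itv/= => /andP[? ?] /andP[? ?].
  rewrite !clamp_id// !ler_norml; lra.
move: tT lower upper; rewrite in_itv/= => /andP[? ?]; rewrite clamp_id// => ? ?.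
by apply/andP; split; lra.
Qed.

(** * Uniqueness in the strip *)

(** Continuity is a consequence of the equation: the integral is a continuous
    function of its upper bound, and the noise is Hölder. *)
Lemma sandwiched_solution_continuous (R : realType) (T lambda Kz y0 : R)
    (phi psi z y : R -> R) (b : R -> R -> R) :
  0 <= T -> 0 < lambda -> holder_bound T lambda Kz z ->
  sandwiched_solution T phi psi b y0 z y -> {within `[0, T], continuous y}.
Proof.
move=> T0 l0 hz [ig yE].
have cz := holder_bound_continuous T0 l0 hz.
pose F t := y0 + \int[@lebesgue_measure R]_(s in `[0, t]) b s (y s) +
  (z \o clamp 0 T) t.
have Fy : {in `[0, T]%classic, F =1 y}.
  move=> t; rewrite inE/= => tT; rewrite (yE _ tT).1 /F.
  by move: tT; rewrite in_itv/= => /andP[? ?]; rewrite /= clamp_id.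
apply: (subspace_eq_continuous Fy).
move=> t; apply: cvgD; last exact: (continuous_subspaceT cz).
apply: cvgD; first exact: cvg_cst.
exact: (parameterized_integral_continuous T0 ig).
Qed.

Lemma sandwich_margin (R : realType) (T : R) (u : R -> R) :
  0 <= T -> {within `[0, T], continuous u} ->
  (forall t, t \in `[0, T] -> 0 < u t) ->
  exists2 e, 0 < e & forall t, t \in `[0, T] -> e <= u t.
Proof.
move=> T0 cu u0; have [m mT hm] := EVT_min T0 cu.
by exists (u m) => //; exact: u0.
Qed.

(** By compactness two solutions lie in a common strip with positive margins,
    where [b] has the Lipschitz constant that the Gronwall argument needs. *)
Lemma sandwiched_solution_unique (R : realType)
    (T lambda Kphi Kpsi Kz y0 : R) (phi psi z y1 y2 : R -> R)
    (b : R -> R -> R) :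
  0 <= T -> 0 < lambda ->
  holder_bound T lambda Kphi phi -> holder_bound T lambda Kpsi psi ->
  holder_bound T lambda Kz z -> 0 < sup_norm T (phi \- psi) ->
  drift_locally_lipschitz T phi psi b ->
  sandwiched_solution T phi psi b y0 z y1 ->
  sandwiched_solution T phi psi b y0 z y2 ->
  forall t, t \in `[0, T] -> y1 t = y2 t.
Proof.
move=> T0 l0 hphi hpsi hz M0 B2 s1 s2 t tT.
have within_c (K : R) g : holder_bound T lambda K g ->
    {within `[0, T], continuous g}.
  move=> /(holder_bound_continuous T0 l0) cg.
  have Fg : {in `[0, T]%classic, g \o clamp 0 T =1 g}.
    by move=> s; rewrite inE/= in_itv/= => /andP[? ?]; rewrite /= clamp_id.
  by apply: (subspace_eq_continuous Fg); exact: continuous_subspaceT.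
have cphi := within_c _ _ hphi; have cpsi := within_c _ _ hpsi.
have margin y : sandwiched_solution T phi psi b y0 z y ->
    exists2 e, 0 < e & forall t, t \in `[0, T] ->
      phi t + e <= y t /\ y t <= psi t - e.
  move=> s; have cy := sandwiched_solution_continuous T0 l0 hz s.
  have [e1 e10 h1] : exists2 e, 0 < e & forall t, t \in `[0, T] ->
      e <= (y \- phi) t.
    apply: sandwich_margin => //; first exact: within_continuousB.
    by move=> r rT; case: s => _ /(_ _ rT)[_] /andP[]; rewrite subr_gt0.
  have [e2 e20 h2] : exists2 e, 0 < e & forall t, t \in `[0, T] ->
      e <= (psi \- y) t.
    apply: sandwich_margin => //; first exact: within_continuousB.
    by move=> r rT; case: s => _ /(_ _ rT)[_] /andP[_]; rewrite subr_gt0.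
  exists (Num.min e1 e2); first by rewrite lt_min e10.
  move=> r rT; have /= := h1 _ rT; have /= := h2 _ rT.
  have [?|?] := leP e1 e2; split; lra.
have [e1 e10 h1] := margin _ s1; have [e2 e20 h2] := margin _ s2.
pose e := Num.min (Num.min e1 e2) (sup_norm T (phi \- psi)) / 3.
have [e0 ee1 ee2 eM] : [/\ 0 < e, e < e1, e < e2 &
    e + e < sup_norm T (phi \- psi)].
  rewrite /e; set M := sup_norm _ _ in M0 *.
  have [?|?] := leP e1 e2.
    by have [?|?] := leP e1 M; split; lra.
  by have [?|?] := leP e2 M; split; lra.
have [L L0 lip] := B2 _ _ e0 e0 eM.
apply/eqP; rewrite -subr_eq0; apply/eqP.
pose g s := b s (y1 s) - b s (y2 s).
have ig : (@lebesgue_measure R).-integrable `[0, T] (EFin \o g).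
  have := integrableB _ s1.1 s2.1 => /(_ (measurable_itv _)).
  by apply: eq_integrable => // s _; rewrite /= EFinB.
apply: (@gronwall_uniqueness R L T g (y1 \- y2)) => //.
- by apply: within_continuousB;
    apply: (sandwiched_solution_continuous T0 l0 hz); eassumption.
- move=> r rT; have rT' : r <= T by move: rT; rewrite in_itv/= => /andP[].
  have i1 := integrable_prefix rT' s1.1; have i2 := integrable_prefix rT' s2.1.
  rewrite /g RintegralB//.
  rewrite /= (s1.2 _ rT).1 (s2.2 _ rT).1; ring.
- move=> r rT; have [? ?] := h1 _ rT; have [? ?] := h2 _ rT.
  have rT' : 0 <= r <= T by move: rT; rewrite in_itv.
  by apply: lip; split => //=; apply/andP; split; lra.
Qed.

Lemma confined_truncated_solution_solves (R : realType) (T e y0 : R)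
    (phi psi z y : R -> R) (b : R -> R -> R) :
  0 < e ->
  (forall t, t \in `[0, T] -> phi t + e < y t < psi t - e) ->
  continuous (fun s => truncated_drift T phi psi b e s (y s)) ->
  (forall t, t \in `[0, T] -> y t = y0 +
    \int[@lebesgue_measure R]_(s in `[0, t])
      truncated_drift T phi psi b e s (y s) + z t) ->
  sandwiched_solution T phi psi b y0 z y.
Proof.
move=> e0 ye cf yE.
have fE s : s \in `[0, T] -> truncated_drift T phi psi b e s (y s) = b s (y s).
  move=> sT; have /andP[? ?] := ye _ sT.
  move: sT; rewrite in_itv/= => /andP[? ?].
  by rewrite /truncated_drift (clamp_id (lo := 0))// clamp_id// ltW.
split.
  have := continuous_integrable_segment 0 T cf.
  by apply: eq_integrable => // s; rewrite inE/= => sT; rewrite /= fE.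
move=> t tT; split; last by have /andP[? ?] := ye _ tT; apply/andP; split; lra.
rewrite yE//; congr (_ + _ + _); apply: eq_Rintegral => s.
rewrite inE/= in_itv/= => /andP[s0 st]; apply: fE.
move: tT; rewrite !in_itv/= s0 => /andP[_]; exact: le_trans.
Qed.

Lemma sandwiched_solution_ext (R : realType) (T y0 : R)
    (phi psi z y y' : R -> R) (b : R -> R -> R) :
  (forall t, t \in `[0, T] -> y' t = y t) ->
  sandwiched_solution T phi psi b y0 z y ->
  sandwiched_solution T phi psi b y0 z y'.
Proof.
move=> yy [ig yE]; split.
  by apply: eq_integrable ig => // s; rewrite inE/= => sT; rewrite /= yy.
move=> t tT; rewrite yy//; have [yt pyp] := yE _ tT; split => //.
rewrite yt; congr (_ + _ + _); apply: eq_Rintegral => s.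
rewrite inE/= in_itv/= => /andP[s0 st]; rewrite yy//.
by move: tT; rewrite !in_itv/= s0 => /andP[_]; exact: le_trans.
Qed.

(** * Measurability and conclusion *)

Lemma euler_measurable (R : realType) (d : measure_display)
    (Omega : measurableType d) (f : R -> R -> R) (z : Omega -> R -> R)
    (y0 h : R) (k : nat) :
  (forall s, continuous (f s)) -> (forall t, measurable_fun setT (z^~ t)) ->
  measurable_fun setT (fun omega => euler f (z omega) y0 h k).
Proof.
move=> cf mz; elim: k => [|k IH] /=.
  by apply: measurable_funD => //; exact: measurable_cst.
apply: measurable_funD; last by apply: measurable_funB; exact: mz.
apply: measurable_funD => //; apply: measurable_funM; last exact: measurable_cst.
apply: (@measurableT_comp _ _ _ _ _ _ (f (k%:R * h))) => //.
exact: continuous_measurable_fun.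
Qed.

Lemma lipschitz_continuous (R : realType) (L : R) (g : R -> R) :
  0 < L -> (forall x y, `|g x - g y| <= L * `|x - y|) -> continuous g.
Proof.
move=> L0 lip x; apply/cvgrPdist_lt => e e0; near=> y.
apply: le_lt_trans (lip _ _) _; rewrite -ltr_pdivlMl//.
near: y; apply: (@cvgr_dist_lt _ _ _ _ _ id); last by rewrite mulr_gt0 ?invr_gt0.
exact: cvg_id.
Unshelve. all: by end_near. Qed.

Unset Implicit Arguments.

Theorem theorem3p1 (R : realType) (d : measure_display)
    (Omega : measurableType d) (P : probability Omega R)
    (T lambda : R) (phi psi : R -> R) (Y0 : R)
    (Z : R -> {RV P >-> R}) (b : R -> R -> R) (gamma : R)
    (T_gt0 : 0 < T) (lambda_gt0 : 0 < lambda) (lambda_lt1 : lambda < 1)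
    (phi_holder : holder_on T lambda phi)
    (psi_holder : holder_on T lambda psi)
    (phi_lt_psi : forall t : R, t \in `[0, T] -> phi t < psi t)
    (Y0_between : phi 0 < Y0 < psi 0)
    (Z_noise : holder_noise T lambda Z)
    (B1 : drift_continuous T phi psi b)
    (B2 : drift_locally_lipschitz T phi psi b)
    (B3 : drift_explosive T phi psi gamma b)
    (B4 : (1 - lambda) / lambda < gamma) :
  exists Y : R -> {RV P >-> R},
    {ae P, forall omega,
      sandwiched_solution T phi psi b Y0 (Z^~ omega) (Y^~ omega) /\
      forall y : R -> R,
        sandwiched_solution T phi psi b Y0 (Z^~ omega) y ->
        forall t : R, t \in `[0, T] -> y t = Y t omega}.
Proof.
have [g0 [ystar [c [ys0 ysM c0 Blo Bhi]]]] := B3.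
have [Kphi hphi] := phi_holder; have [Kpsi hpsi] := psi_holder.
have [aeZ0 [Lambda hZ]] := Z_noise.
have T0 := ltW T_gt0.
have gap := drift_gap c0 ys0 phi_lt_psi Blo Bhi.
have /andP[Yphi Ypsi] := Y0_between.
have M0 : 0 < sup_norm T (phi \- psi) by lra.
have cphi := holder_bound_continuous T0 lambda_gt0 hphi.
have cpsi := holder_bound_continuous T0 lambda_gt0 hpsi.
(* The start must be above both barriers 2 * e, and the barriers inside the
   zones where the drift is singular; the factor 1/2 absorbs the 2. *)
pose e1 := Num.min ystar (Num.min (Y0 - phi 0) (psi 0 - Y0)) / 2.
have [e10 e1y e1phi e1psi] : [/\ 0 < e1, 2 * e1 <= ystar,
    2 * e1 <= Y0 - phi 0 & 2 * e1 <= psi 0 - Y0].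
  rewrite /e1; have [?|?] := leP (Y0 - phi 0) (psi 0 - Y0).
    by have [?|?] := leP ystar (Y0 - phi 0); split; lra.
  by have [?|?] := leP ystar (psi 0 - Y0); split; lra.
pose e n : R := e1 * harmonic n.
have e_gt0 n : 0 < e n by rewrite mulr_gt0// invr_gt0.
have e_le n : e n <= e1.
  have hn1 : harmonic n <= 1 :> R by rewrite invf_le1// ler1n.
  by rewrite ler_piMr// ltW.
have e2_le n : 2 * e n <= 2 * e1 by rewrite ler_wpM2l.
have e_cvg : e @ \oo --> (0 : R).
  by rewrite -(mulr0 e1); apply: cvgMl_tmp; exact: cvg_harmonic.
have gap_e n t : t \in `[0, T] -> phi t + 2 * e n <= psi t.
  by move=> /gap; have := e_le n; lra.
pose f n := truncated_drift T phi psi b (e n).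
have /choice[L hL] n : exists L, 0 < L /\ forall s x y,
    `|f n s x - f n s y| <= L * `|x - y|.
  have eM : e n < sup_norm T (phi \- psi) by have := e_le n; lra.
  have [L L0 lip] := truncated_drift_lipschitz B2 T0 (e_gt0 n) eM (gap_e n).
  by exists L.
have cf n y : continuous y -> continuous (fun s => f n s (y s)).
  exact: (truncated_drift_continuous B1 T0 (e_gt0 n) (gap_e n) cphi cpsi).
(* Recentred noise starts at 0 on every path, not just almost surely, so that
   the equation can be solved for all omega and its solution is measurable. *)
pose z omega t := Z t omega - Z 0 omega.
have hz omega : holder_bound T lambda (Lambda omega) (z omega).
  move=> t s tT sT; have [_ /(_ t s tT sT)] := hZ omega.
  by rewrite /z (_ : _ - _ - _ = Z t omega - Z s omega)//; ring.
pose zc omega := z omega \o clamp 0 T.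
have zcE omega t : t \in `[0, T] -> zc omega t = z omega t.
  by rewrite in_itv/= => /andP[? ?]; rewrite /zc /= clamp_id.
have /choice[y hy] (p : nat * Omega) : exists y : R -> R, continuous y /\
    forall t, t \in `[0, T] -> y t = Y0 +
      \int[@lebesgue_measure R]_(s in `[0, t]) f p.1 s (y s) + zc p.2 t.
  have [L0 lip] := hL p.1.
  have czc := holder_bound_continuous T0 lambda_gt0 (hz p.2).
  have [y cy yE] := picard_existence Y0 L0 T0 (cf p.1) lip czc.
  by exists y.
have /choice[N hN] omega : exists N, forall n, (N <= n)%N ->
    sandwiched_solution T phi psi b Y0 (z omega) (y (n, omega)).
  pose K := `|Lambda omega| + `|Kphi| + `|Kpsi| + 1.
  have [K0 Kp Kq] : [/\ 0 < K, Lambda omega + Kphi <= K &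
      Lambda omega + Kpsi <= K].
    have := ler_norm (Lambda omega); have := ler_norm Kphi.
    have := ler_norm Kpsi; have := normr_ge0 (Lambda omega).
    by have := normr_ge0 Kphi; have := normr_ge0 Kpsi; rewrite /K; split; lra.
  have [e2 e20 he2] :=
    holder_loses_to_singular_drift lambda_gt0 lambda_lt1 c0 K0 B4.
  have [N _ hN] := cvgr_lt _ e_cvg _ e20.
  exists N => n Nn; have [cy yE] := hy (n, omega).
  have yE' t : t \in `[0, T] -> y (n, omega) t = Y0 +
      \int[@lebesgue_measure R]_(s in `[0, t])
        truncated_drift T phi psi b (e n) s (y (n, omega) s) + z omega t.
    by move=> tT; rewrite yE// zcE.
  apply: (confined_truncated_solution_solves (e_gt0 n) _ (cf n _ cy)) => //.
  apply: (truncated_solution_confined T0 lambda_gt0 g0 c0 (e_gt0 n) _ hphi hpsi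
    (hz omega) Kp Kq _ gap _ _ Blo Bhi _ cy (cf n _ cy)) => //.
  - exact: le_trans (e2_le n) e1y.
  - by rewrite /z subrr.
  - exact: le_trans (e2_le n) e1phi.
  - exact: le_trans (e2_le n) e1psi.
  - by apply: he2 => //; apply/ltW; exact: hN.
  - exact: yE'.
have agree omega y1 y2 :
    sandwiched_solution T phi psi b Y0 (z omega) y1 ->
    sandwiched_solution T phi psi b Y0 (z omega) y2 ->
    forall t, t \in `[0, T] -> y1 t = y2 t.
  exact: (sandwiched_solution_unique T0 lambda_gt0 hphi hpsi (hz omega)).
pose Yfun t omega := y (N omega, omega) (clamp 0 T t).
have mzc t : measurable_fun setT (fun omega => zc omega t).
  by apply: measurable_funB.
have mY t : measurable_fun setT (Yfun t).
  have tT := clamp_in t T0.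
  apply: (@measurable_fun_cvg _ _ _ _
    (fun n omega => y (n, omega) (clamp 0 T t))) => [n|omega _].
    have [L0 lip] := hL n.
    apply: (@measurable_fun_cvg _ _ _ _ (fun m omega =>
      euler (f n) (zc omega) Y0 (clamp 0 T t / m.+1%:R) m.+1)) => [m|omega _].
      apply: euler_measurable => // s.
      exact: lipschitz_continuous L0 (lip s).
    have [cy yE] := hy (n, omega).
    exact: (euler_cvg L0 lip (cf n _ cy) yE tT).
  (* By uniqueness all levels from N omega on give the same solution. *)
  apply: cvg_near_cst; exists (N omega) => // n /= Nn.
  exact: agree (hN _ _ Nn) (hN _ _ (leqnn _)) _ tT.
have /choice[Y YE] t : exists X : {RV P >-> R}, X = Yfun t :> (Omega -> R).
  pose m := isMeasurableFun.Build _ _ _ _ (Yfun t) (mY t).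
  by exists (HB.pack_for {mfun Omega >-> R} (Yfun t) m).
exists Y; apply: filterS aeZ0 => omega Z0.
have zE : z omega = Z^~ omega by apply/funext => t; rewrite /z Z0 subr0.
have Yy t : t \in `[0, T] -> Y t omega = y (N omega, omega) t.
  by rewrite in_itv/= => /andP[? ?]; rewrite YE /Yfun clamp_id.
have sol := hN omega _ (leqnn _); have agree_omega := agree omega.
rewrite zE in sol agree_omega.
split=> [|y' sol' t tT]; first exact: sandwiched_solution_ext Yy sol.
by rewrite Yy//; exact: agree_omega sol' sol _ tT.
Qed.
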